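(* Let $H$ be a finite dimensional $G$-graded $G$-module, and let $\circ$ be the multiplication on $\mathrm{Br}\llbracket H^\ast \rrbracket$ given by the composition \[ \mathrm{Br}\llbracket H^\ast \rrbracket \otimes \mathrm{Br}\llbracket H^\ast \rrbracket \hookrightarrow \mathrm{T}\llbracket H^\ast \rrbracket \otimes \mathrm{T}\llbracket H^\ast \rrbracket \xrightarrow{\mu} \mathrm{T}\llbracket H^\ast \rrbracket \xrightarrow{\mathcal{B}} \mathrm{Br}\llbracket H^\ast \rrbracket , \] where $\mu$ is juxtaposition and $\mathcal{B}=\prod_n \mathcal{B}_n$ is the total braidization. Then $(\mathrm{Br}\llbracket H^\ast \rrbracket,\circ)$ is a braided-commutative algebra with unity. Moreover, for each morphism $\phi : H \to K$ of finite dimensional $G$-graded $G$-modules, the induced linear map \[ \phi^\ast : \mathrm{Br}\llbracket K^\ast \rrbracket \to \mathrm{Br}\llbracket H^\ast \rrbracket \] is a morphism of algebras with unity.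
   Context: $G$ is a finite group and $k$ a field of characteristic zero. A $G$-graded $G$-module is a vector space $H=\bigoplus_{m\in G}H_m$ with a $G$-action satisfying $\gamma\cdot H_m = H_{\gamma m\gamma^{-1}}$; morphisms are $G$-equivariant grading-preserving linear maps. These form the braided monoidal category $D(k[G])$-$\mathbf{Mod}$ with braiding $V_g\otimes W\to W\otimes V_g$, $v\otimes w\mapsto (g\cdot w)\otimes v$ for $v\in V_g$. Hence the braid group $B_n$ acts on $V^{\otimes n}$; e.g. the generator $b_1$ sends $v_1\otimes v_2\otimes\cdots$ with $v_1\in V_{\gamma_1}$ to $(\gamma_1\cdot v_2)\otimes v_1\otimes\cdots$. For a finite dimensional object $V$, $\mathrm{T}\llbracket V\rrbracket=\prod_{n\ge0}V^{\otimes n}$, $\mathrm{Br}^nV=(V^{\otimes n})^{B_n}$ (the $B_n$-invariant tensors) and $\mathrm{Br}\llbracket V\rrbracket=\prod_{n\ge0}\mathrm{Br}^nV$. The dual $H^\ast$ is a $G$-graded $G$-module via $(\gamma\cdot x)(v)=x(\gamma^{-1}\cdot v)$ and $(H^\ast)_m=(H_{m^{-1}})^\ast$. Braidization: $B_n$ acts on $G^n$ by $b_i(\gamma_1,\dots,\gamma_n)=(\dots,\gamma_i\gamma_{i+1}\gamma_i^{-1},\gamma_i,\dots)$; a braid $b$ acting on $\boldsymbol\gamma$ determines an element $b_{\boldsymbol\gamma}\in G^n\rtimes S_n$, and the groupoid $\mathcal G^n$ has objects $G^n$ and morphisms $\boldsymbol\gamma\to\boldsymbol\gamma'$ the distinct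 such elements $b_{\boldsymbol\gamma}$ with $b\boldsymbol\gamma=\boldsymbol\gamma'$. Let $A_{\boldsymbol\gamma}$ be the set of all morphisms of $\mathcal G^n$ with source $\boldsymbol\gamma$. For $v\in V_{\boldsymbol\gamma}:=V_{\gamma_1}\otimes\cdots\otimes V_{\gamma_n}$ set $\mathcal{B}_n(v)=\frac{1}{|A_{\boldsymbol\gamma}|}\sum_{b_{\boldsymbol\gamma}\in A_{\boldsymbol\gamma}}b_{\boldsymbol\gamma}\cdot v$ (where $b_{\boldsymbol\gamma}$ acts as any braid realizing it), extended linearly; this is applied here to $V=H^\ast$. Braided-commutativity means $\circ = \circ\circ\Phi$ with $\Phi$ the braiding. *)

(* Defs.v *)
From HB Require Import structures.
From mathcomp Require Import all_boot all_order all_algebra all_fingroup.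
From mathcomp Require Import boolp.

Set Implicit Arguments.
Unset Strict Implicit.
Unset Printing Implicit Defensive.
Import GRing.Theory.
Local Open Scope ring_scope.

(* A finite dimensional G-graded G-module, given by a homogeneous basis       *)
(* (e_i)_{i : gidx}, with e_i in H_(gdeg i), and the action matrices:         *)
(* gact g i j = coefficient of e_i in g . e_j.                                *)
Record gmod (gT : finGroupType) (k : fieldType) := GMod {
  gidx : finType;
  gdeg : gidx -> gT;
  gact : gT -> gidx -> gidx -> k;
  gact1 : forall i j, gact 1%g i j = (i == j)%:R;
  gactM : forall g h i j, gact (g * h)%g i j = \sum_l gact g i l * gact h l j;
  gact_grade : forall g i j, gact g i j != 0 ->
                 gdeg i = (g * gdeg j * g^-1)%g }.
Arguments gidx {gT k} _.
Arguments gdeg {gT k} _ _.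
Arguments gact {gT k} _ _ _ _.

(* Morphism H -> K: phi l i = coefficient of e_l (in K) in phi(e_i). *)
Definition gmod_mor (gT : finGroupType) (k : fieldType) (H K : gmod gT k)
    (phi : gidx K -> gidx H -> k) : Prop :=
  (forall l i, phi l i != 0 -> gdeg K l = gdeg H i) /\
  (forall g l i, \sum_m gact K g l m * phi m i = \sum_j phi l j * gact H g j i).

(* The dual H^*, in the dual basis (e_i^* ) : (H^* )_m = (H_(m^-1))^*,
   (g . x)(v) = x(g^-1 . v). *)
Definition dual_deg (gT : finGroupType) (k : fieldType) (H : gmod gT k)
  (i : gidx H) : gT := ((gdeg H i)^-1)%g.
Definition dual_act (gT : finGroupType) (k : fieldType) (H : gmod gT k)
  (g : gT) (l j : gidx H) : k := gact H (g^-1)%g j l.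

Section Machinery.
Variables (gT : finGroupType) (k : fieldType) (J : finType)
          (deg : J -> gT) (act : gT -> J -> J -> k).

(* Elements of T[[V]] = prod_n V^{(x)n}: coefficient of the basis tensor
   e_(w_1) (x) ... (x) e_(w_n) for each word w. *)
Definition tser := seq J -> k.

(* Elements of G^n x| S_n, as pairs (g, s), acting on V_gamma by
   v_1 (x)...(x) v_n |-> (g_1 . v_(s 1)) (x) ... (x) (g_n . v_(s n)). *)
Definition elt (n : nat) := ({ffun 'I_n -> gT} * {ffun 'I_n -> 'I_n})%type.

(* Braid words: (i, true) = b_(i+1), (i, false) = b_(i+1)^-1 (0-based i). *)
Definition bword (n : nat) := seq ('I_n * bool).
Definition valid_bword n (wd : bword n) := all (fun p : 'I_n * bool => ((val p.1).+1 < n)%N) wd.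

(* One step: current grading c, current element (g, s); apply a generator. *)
Definition bstep n (st : {ffun 'I_n -> gT} * elt n) (p : 'I_n * bool) :=
  let: (c, (g, s)) := st in
  let: (i, pos) := p in
  let i' := insubd i (val i).+1 in
  let s' := [ffun j => s (if j == i then i' else if j == i' then i else j)] in
  if pos then
    ([ffun j => if j == i then (c i * c i' * (c i)^-1)%g
                else if j == i' then c i else c j],
     ([ffun j => if j == i then (c i * g i')%g
                 else if j == i' then g i else g j], s'))
  else
    ([ffun j => if j == i then c i'
                else if j == i' then ((c i')^-1 * c i * c i')%g else c j],
     ([ffun j => if j == i then g i'
                 else if j == i' then ((c i')^-1 * g i)%g else g j], s')).

Definition belt n (c : {ffun 'I_n -> gT}) (wd : bword n) : elt n :=
  (foldl (@bstep n) (c, ([ffun => 1%g], [ffun j => j])) wd).2.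

(* A_gamma : all morphisms of the groupoid G^n with source gamma. *)
Definition Aset n (c : {ffun 'I_n -> gT}) : {set elt n} :=
  [set a | `[< exists wd : bword n, valid_bword wd /\ belt c wd = a >]].

Definition degt n (w : n.-tuple J) : {ffun 'I_n -> gT} :=
  [ffun j => deg (tnth w j)].

(* coefficient of e_u in a . e_w *)
Definition ecoef n (a : elt n) (u w : n.-tuple J) : k :=
  \prod_(j < n) act (a.1 j) (tnth u j) (tnth w (a.2 j)).

Definition bact n (wd : bword n) (x : tser) (u : n.-tuple J) : k :=
  \sum_(w : n.-tuple J) x w * ecoef (belt (degt w) wd) u w.

Definition isBr (x : tser) : Prop :=
  forall n (wd : bword n) (u : n.-tuple J), valid_bword wd -> bact wd x u = x u.

Definition braidize_n n (x : tser) (u : n.-tuple J) : k :=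
  \sum_(w : n.-tuple J) x w *
     ((#|Aset (degt w)|%:R)^-1 * \sum_(a in Aset (degt w)) ecoef a u w).
Definition braidize (x : tser) : tser := fun u => braidize_n x (in_tuple u).

Definition juxt (x y : tser) : tser :=
  fun u => \sum_(i < (size u).+1) x (take i u) * y (drop i u).

Definition circ (x y : tser) : tser := braidize (juxt x y).

Definition tone : tser := fun u => if u is [::] then 1 else 0.

Definition homog (g : gT) (x : tser) : Prop :=
  forall u, x u != 0 -> (\prod_(j <- u) deg j)%g = g.

Definition tgact (g : gT) (x : tser) : tser :=
  fun u => \sum_(w : (size u).-tuple J) x w *
              \prod_(j < size u) act g (tnth (in_tuple u) j) (tnth w j).

Definition braided_comm_unital_algebra : Prop :=
  (forall x y, isBr x -> isBr y -> isBr (circ x y)) /\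
  isBr tone /\
  (forall x y z, isBr x -> isBr y -> isBr z ->
     circ (circ x y) z = circ x (circ y z)) /\
  (forall x, isBr x -> circ tone x = x /\ circ x tone = x) /\
  (forall (a : k) x y z, isBr x -> isBr y -> isBr z ->
     circ (fun u => a * x u + y u) z = (fun u => a * circ x z u + circ y z u) /\
     circ z (fun u => a * x u + y u) = (fun u => a * circ z x u + circ z y u)) /\
  (forall g x y, isBr x -> isBr y -> homog g x ->
     circ x y = circ (tgact g y) x).

End Machinery.

(* phi^* : T[[K^*]] -> T[[H^*]], the tensor powers of the transpose of phi *)
Definition pullback (gT : finGroupType) (k : fieldType) (H K : gmod gT k)
    (phi : gidx K -> gidx H -> k) (y : tser k (gidx K)) : tser k (gidx H) :=
  fun w => \sum_(u : (size w).-tuple (gidx K)) y u *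
             \prod_(j < size w) phi (tnth u j) (tnth (in_tuple w) j).

Definition BrH (gT : finGroupType) (k : fieldType) (H : gmod gT k) :=
  isBr (@dual_deg gT k H) (@dual_act gT k H).
Definition circH (gT : finGroupType) (k : fieldType) (H : gmod gT k) :=
  circ (@dual_deg gT k H) (@dual_act gT k H).

(* Main.v *)
(* On words of length n, braids act on the finite set of pairs (grading, element
   of G^n x| S_n) through a finite group, and B_n is the average over that group
   of an honest representation; so B_n is the projection onto the invariants,
   and B_n o b = B_n for every braid b.  A coefficient of B(t), as a linear
   functional of t, is therefore braid-invariant; the restriction of a
   braid-invariant functional to one factor of a juxtaposition is again
   braid-invariant, whence B(B(s) (x) t) = B(s (x) t) = B(s (x) B(t)), which gives
   associativity.  Moving a whole word across another is a braid, which gives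
   braided-commutativity; phi^* commutes with braids and with juxtaposition. *)
Require Import Defs.
From HB Require Import structures.
From mathcomp Require Import all_boot all_order all_algebra all_fingroup.
From mathcomp Require Import boolp.
Import GRing.Theory.
Local Open Scope ring_scope.

Set Implicit Arguments.
Unset Strict Implicit.
Unset Printing Implicit Defensive.

(** * Sums over words *)

(** Series take plain words and re-form them as tuples of length [size u]; this returns to a tuple
    whose length is a given [n]. *)
Lemma in_tupleE_dep (T J : Type) (P : forall n, n.-tuple J -> T) n
    (u : n.-tuple J) :
  P (size u) (in_tuple u) = P n u.
Proof.
case: u => u u_n /=; have e := eqP u_n; subst n.
by congr (P _ _); apply/val_inj.
Qed.

Section WordSums.
Variables (k : fieldType) (J : finType).
Implicit Types (F : seq J -> k) (v w : seq J).

(** Words enter [F] as plain sequences, so that cutting and concatenating them needs no casts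
    between tuple types. *)
Definition sumw n F : k := \sum_(w : n.-tuple J) F w.

Lemma sumw0 F : sumw 0 F = F [::].
Proof.
rewrite /sumw (bigD1 [tuple]) //= big1 ?addr0 // => w.
by rewrite tuple0 => /eqP.
Qed.

Lemma sumwS n F : sumw n.+1 F = \sum_j sumw n (fun w => F (j :: w)).
Proof.
rewrite /sumw pair_big /=.
rewrite (reindex (fun p : J * n.-tuple J => [tuple of p.1 :: p.2])) //=.
exists (fun w : n.+1.-tuple J => (thead w, [tuple of behead w])) => [[j w] _|w _] /=.
  by congr (_, _); apply/val_inj.
by rewrite [RHS]tuple_eta; apply/val_inj.
Qed.

Lemma eq_sumw n F F' :
  (forall w, size w = n -> F w = F' w) -> sumw n F = sumw n F'.
Proof. by move=> eqF; apply: eq_bigr => w _; rewrite eqF ?size_tuple. Qed.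

Lemma sumw_cat p q F :
  sumw (p + q) F = sumw p (fun v => sumw q (fun w => F (v ++ w))).
Proof.
elim: p F => [|p IH] F; first by rewrite sumw0.
by rewrite addSn !sumwS; apply: eq_bigr => j _; rewrite IH.
Qed.

Lemma sumw_suml n (I : finType) (F : I -> seq J -> k) :
  sumw n (fun w => \sum_i F i w) = \sum_i sumw n (F i).
Proof. exact: exchange_big. Qed.

Lemma mulr_sumw n a F : a * sumw n F = sumw n (fun w => a * F w).
Proof. exact: mulr_sumr. Qed.

Lemma sumwD n F F' : sumw n (fun w => F w + F' w) = sumw n F + sumw n F'.
Proof. exact: big_split. Qed.

End WordSums.

(** * Matrix coefficients of tensor powers *)

Section PairProducts.
Variables (k : fieldType) (A B : Type).
Implicit Types (f : A -> B -> k) (u : seq A) (w : seq B).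

Fixpoint pairprod f u w : k :=
  match u, w with a :: u', b :: w' => f a b * pairprod f u' w' | _, _ => 1 end.

Lemma pairprod_tuple n f (u : n.-tuple A) (w : n.-tuple B) :
  \prod_(i < n) f (tnth u i) (tnth w i) = pairprod f u w.
Proof.
elim: n u w => [|n IH] u w; first by rewrite big_ord0 !tuple0.
case/tupleP: u => a u; case/tupleP: w => b w.
rewrite big_ord_recl !tnth0 /= -IH; congr (_ * _).
by apply: eq_bigr => i _; rewrite !tnthS.
Qed.

Lemma pairprod_cat f u1 u2 w1 w2 : size u1 = size w1 ->
  pairprod f (u1 ++ u2) (w1 ++ w2) = pairprod f u1 w1 * pairprod f u2 w2.
Proof.
by elim: u1 w1 => [|a u1 IH] [|b w1] //= => [_|[/IH->]]; rewrite ?mul1r ?mulrA.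
Qed.

End PairProducts.

(** * Sums of products over words, and pure tensors *)

Section SumProducts.
Variables (k : fieldType) (J : finType).
Implicit Types (fs : seq (J -> k)) (F : seq J -> k).

Lemma sum_prod_tuple n (f : 'I_n -> J -> k) :
  \sum_(v : n.-tuple J) \prod_(i < n) f i (tnth v i) = \prod_(i < n) \sum_j f i j.
Proof.
rewrite bigA_distr_bigA.
rewrite (reindex (fun h : {ffun 'I_n -> J} => [tuple h i | i < n])) /=.
  by apply: eq_bigr => h _; apply: eq_bigr => i _; rewrite tnth_mktuple.
exists (fun v : n.-tuple J => [ffun i => tnth v i]) => [h _|v _].
  by apply/ffunP => i; rewrite ffunE tnth_mktuple.
by apply/eq_from_tnth => i; rewrite tnth_mktuple ffunE.
Qed.

(** As [s] is a permutation, each letter of [v] meets exactly one factor of either product, so the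
    sum splits position by position. *)
Lemma sum_prod_perm n (s : 'I_n -> 'I_n) (A B : 'I_n -> J -> k) : injective s ->
  \sum_(v : n.-tuple J)
     (\prod_i A i (tnth v (s i))) * (\prod_i B i (tnth v i)) =
  \prod_i \sum_j A i j * B (s i) j.
Proof.
move=> s_inj; pose t := invF s_inj.
rewrite [RHS](eq_bigr (fun i => \sum_j A (t (s i)) j * B (s i) j)); last first.
  by move=> i _; rewrite /t invF_f.
rewrite -(reindex_inj s_inj (P := predT) (F := fun i => \sum_j A (t i) j * B i j)) /=.
rewrite -sum_prod_tuple; apply: eq_bigr => v _; rewrite big_split /=; congr (_ * _).
by rewrite [RHS](reindex_inj s_inj); apply: eq_bigr => i _; rewrite /t invF_f.
Qed.

(** The linear extension of [F], evaluated on the pure tensor with factors [fs]. The recursion lets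
    basis vectors among the factors be summed away one at a time. *)
Fixpoint tsum fs F : k :=
  if fs is f :: fs' then \sum_j f j * tsum fs' (fun v => F (j :: v)) else F [::].

Lemma tsumE fs F :
  tsum fs F = sumw (size fs) (fun v => pairprod (fun f x => f x) fs v * F v).
Proof.
elim: fs F => [|f fs IH] F /=; first by rewrite sumw0 /= mul1r.
rewrite sumwS; apply: eq_bigr => j _; rewrite IH mulr_sumw.
by apply: eq_sumw => v _; rewrite mulrA.
Qed.

Definition delta (a : J) : J -> k := fun z => (z == a)%:R.

Lemma sum_delta a (f : J -> k) : \sum_j delta a j * f j = f a.
Proof.
rewrite (bigD1 a) //= /delta eqxx mul1r big1 ?addr0 // => j /negPf->.
by rewrite mul0r.
Qed.

Lemma tsum_delta (s : seq J) fs F :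
  tsum (map delta s ++ fs) F = tsum fs (fun v => F (s ++ v)).
Proof. by elim: s F => [|a s IH] F //=; rewrite sum_delta IH. Qed.

End SumProducts.

(** * Juxtaposition of series *)

Section Juxtaposition.
Variables (k : fieldType) (J : finType).
Implicit Types x y z : tser k J.

Lemma sum_juxt n x y (F : seq J -> k) :
  sumw n (fun w => juxt x y w * F w) =
  \sum_(p < n.+1) sumw p (fun v => sumw (n - p) (fun w => x v * y w * F (v ++ w))).
Proof.
transitivity (sumw n (fun u =>
    \sum_(p < n.+1) x (take p u) * y (drop p u) * F u)).
  by apply: eq_sumw => u <-; rewrite mulr_suml.
rewrite sumw_suml; apply: eq_bigr => p _.
have le_pn : (p <= n)%N by rewrite -ltnS.
rewrite -{1}(subnKC le_pn) sumw_cat; apply: eq_sumw => v sz_v.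
by apply: eq_sumw => w _; rewrite take_size_cat // drop_size_cat.
Qed.

Lemma juxt_nil x y : juxt x y [::] = x [::] * y [::].
Proof. by rewrite /juxt big_ord1. Qed.

Lemma juxt_cons x y a u :
  juxt x y (a :: u) = x [::] * y (a :: u) + juxt (fun v => x (a :: v)) y u.
Proof. by rewrite /juxt big_ord_recl. Qed.

Lemma juxt_linearl a x y z u :
  juxt (fun v => a * x v + y v) z u = a * juxt x z u + juxt y z u.
Proof.
rewrite /juxt mulr_sumr -big_split; apply: eq_bigr => i _ /=.
by rewrite mulrDl mulrA.
Qed.

Lemma juxt_linearr a x y z u :
  juxt z (fun v => a * x v + y v) u = a * juxt z x u + juxt z y u.
Proof.
rewrite /juxt mulr_sumr -big_split; apply: eq_bigr => i _ /=.
by rewrite mulrDr mulrCA.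
Qed.

Lemma juxtA x y z : juxt (juxt x y) z = juxt x (juxt y z).
Proof.
(* [x] is kept general because [juxt_cons] replaces it by its shift [fun v => x (a :: v)]. *)
apply/funext => u; elim: u x => [|a u IH] x; first by rewrite !juxt_nil mulrA.
rewrite !juxt_cons -IH juxt_nil.
have -> : (fun v => juxt x y (a :: v)) =
    (fun v => x [::] * y (a :: v) + juxt (fun w => x (a :: w)) y v).
  by apply/funext => v; rewrite juxt_cons.
by rewrite juxt_linearl mulrDr !addrA !mulrA.
Qed.

Lemma juxt1l x : juxt (@tone k J) x = x.
Proof.
apply/funext => -[|a u]; first by rewrite juxt_nil mul1r.
by rewrite juxt_cons mul1r /juxt big1 ?addr0 // => i _; rewrite mul0r.
Qed.

Lemma juxt1r x : juxt x (@tone k J) = x.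
Proof.
apply/funext => u; elim: u x => [|a u IH] x; first by rewrite juxt_nil mulr1.
by rewrite juxt_cons mulr0 add0r IH.
Qed.

End Juxtaposition.

(** * The finite quotient of the braid group *)

Section BraidGroup.
Variables (gT : finGroupType) (n : nat).
Implicit Types (c : {ffun 'I_n -> gT}) (a b : elt gT n) (p : 'I_n * bool).

Definition state : Type := ({ffun 'I_n -> gT} * elt gT n)%type.
HB.instance Definition _ := Finite.on state.
Implicit Types st : state.

Definition elt1 : elt gT n := ([ffun => 1%g], [ffun j => j]).

(** The product in G^n x| S_n, with [b] acting first. *)
Definition elt_mul a b : elt gT n :=
  ([ffun j => (a.1 j * b.1 (a.2 j))%g], [ffun j => b.2 (a.2 j)]).

(** The grading at the end of the morphism [a] with source [c]. *)
Definition etgt c a : {ffun 'I_n -> gT} :=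
  [ffun j => (a.1 j * c (a.2 j) * (a.1 j)^-1)%g].

Definition valid_gen p := ((val p.1).+1 < n)%N.

Definition translate b st : state := (st.1, elt_mul st.2 b).

Lemma elt_mul1 a : elt_mul elt1 a = a.
Proof. by case: a => g s; congr pair; apply/ffunP => j; rewrite ffunE /= !ffunE ?mul1g. Qed.

Lemma etgt1 c : etgt c elt1 = c.
Proof. by apply/ffunP => j; rewrite ffunE /= !ffunE mul1g invg1 mulg1. Qed.

Lemma val_insubd_succ (i : 'I_n) :
  ((val i).+1 < n)%N -> val (insubd i (val i).+1) = (val i).+1.
Proof. by move=> lt_in; rewrite val_insubd lt_in. Qed.

Lemma insubd_succ_neq (i : 'I_n) :
  ((val i).+1 < n)%N -> (insubd i (val i).+1 == i) = false.
Proof.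
move=> lt_in; apply/eqP => /(congr1 val) /=.
by rewrite val_insubd_succ // => /eqP; rewrite eqn_leq ltnn.
Qed.

(** A generator multiplies the element on the left, by a factor that depends on the grading
    alone. *)
Lemma bstep_translate b st p :
  bstep (translate b st) p = translate b (bstep st p).
Proof.
case: st p => c [g s] [i []]; rewrite /bstep /translate /elt_mul /=.
  congr (_, (_, _)); apply/ffunP => j; rewrite [LHS]ffunE [RHS]ffunE /= !ffunE //=.
  by case: (j == i); case: (j == _); rewrite ?mulgA.
congr (_, (_, _)); apply/ffunP => j; rewrite [LHS]ffunE [RHS]ffunE /= !ffunE //=.
by case: (j == i); case: (j == _); rewrite ?mulgA.
Qed.

Lemma bstepK st p : valid_gen p -> bstep (bstep st p) (p.1, ~~ p.2) = st.
Proof.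
case: p => i e; rewrite /valid_gen /= => lt_in.
have ne := insubd_succ_neq lt_in.
set i' := insubd i _ in ne *.
have ne' : (i == i') = false by rewrite eq_sym.
case: st e => c [g s] []; rewrite /bstep /= -/i'.
  congr (_, (_, _)); apply/ffunP => j; rewrite [LHS]ffunE /= !ffunE ?eqxx ?ne ?ne'.
  - by case: eqP => [->//|_]; case: eqP => [->|//]; rewrite !mulgA mulVg mul1g mulgKV.
  - by case: eqP => [->//|_]; case: eqP => [->|//]; rewrite mulKg.
  - case: (eqVneq j i) => [->|/negPf ne_i]; first by rewrite eqxx ne.
    by case: (eqVneq j i') => [->|/negPf ne_i']; rewrite ?eqxx ?ne_i ?ne_i'.
congr (_, (_, _)); apply/ffunP => j; rewrite [LHS]ffunE /= !ffunE ?eqxx ?ne ?ne'.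
- case: eqP => [->|_]; first by rewrite !mulgA mulgV mul1g mulgK.
  by case: eqP => [->|//].
- case: eqP => [->|_]; first by rewrite mulKVg.
  by case: eqP => [->|//].
- case: (eqVneq j i) => [->|/negPf ne_i]; first by rewrite eqxx ne.
  by case: (eqVneq j i') => [->|/negPf ne_i']; rewrite ?eqxx ?ne_i ?ne_i'.
Qed.

Lemma bstep_inj p : valid_gen p -> injective (fun st : state => bstep st p : state).
Proof. by move=> vp st st' eq_st; rewrite -(bstepK st vp) eq_st bstepK. Qed.

Definition brun (wd : bword n) (st : state) : state := foldl (@bstep gT n) st wd.

Lemma brun_inj wd : valid_bword wd -> injective (brun wd).
Proof.
elim: wd => [_ st st' //|p wd IH]; rewrite /valid_bword /= => /andP[vp vwd] st st' eq_st.
exact/(bstep_inj vp)/(IH vwd).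
Qed.

(* The perms of the finite set of states that are realized by braid words: a
   finite quotient of the braid group B_n. *)
Definition braid_set : {set {perm state}} :=
  [set q : {perm state} |
     `[< exists2 wd : bword n, valid_bword wd & forall st, q st = brun wd st >]].

Lemma braid_group_set : group_set braid_set.
Proof.
apply/group_setP; split=> [|q r].
  by rewrite inE; apply/asboolP; exists [::] => // st; rewrite perm1.
rewrite !inE => /asboolP[wd vwd qE] /asboolP[wd' vwd' rE].
apply/asboolP; exists (wd ++ wd') => [|st].
  by rewrite /valid_bword all_cat; apply/andP.
by rewrite permM rE qE /brun foldl_cat.
Qed.
Canonical braid_group := Group braid_group_set.

Lemma braid_wordP q : q \in braid_group ->
  exists2 wd : bword n, valid_bword wd & forall st, q st = brun wd st.
Proof. by rewrite inE => /asboolP. Qed.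

Definition word_perm wd (vwd : valid_bword wd) : {perm state} :=
  perm (@brun_inj wd vwd).

Lemma word_perm_in wd (vwd : valid_bword wd) : word_perm vwd \in braid_group.
Proof. by rewrite inE; apply/asboolP; exists wd => // st; rewrite permE. Qed.

(** Consequently the image of [(c, b)] is determined by the image of [(c, elt1)]. *)
Lemma braid_translate q b st : q \in braid_group ->
  q (translate b st) = translate b (q st).
Proof.
case/braid_wordP=> wd _ qE; rewrite !qE.
elim: wd st {qE} => [|p wd IH] st //=.
by rewrite -[LHS]/(brun wd (bstep (translate b st) p)) bstep_translate IH.
Qed.

Definition braid_elt (q : {perm state}) c : elt gT n := (q (c, elt1)).2.

(** An invariant carried along braid words. It makes the grading of a state a function of its
    element, and supplies the injectivity on positions that the type [elt] does not impose. *)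
Lemma bstep_etgt c0 p st : valid_gen p ->
  st.1 = etgt c0 st.2 /\ injective st.2.2 ->
  (bstep st p).1 = etgt c0 (bstep st p).2 /\ injective (bstep st p).2.2.
Proof.
case: p => i e; rewrite /valid_gen /= => lt_in.
have ne := insubd_succ_neq lt_in.
set i' := insubd i _ in ne *.
have swap_inj : injective (fun j => if j == i then i' else if j == i' then i else j).
  apply: inv_inj => j.
  case: (eqVneq j i) => [->|/negPf ne_i]; first by rewrite ne eqxx.
  by case: (eqVneq j i') => [->|/negPf ne_i']; rewrite ?eqxx ?ne_i ?ne_i'.
case: st e => c [g s] [] /= [cE s_inj]; rewrite -/i'; split.
- apply/ffunP => j; rewrite !ffunE /=.
  case: eqP => [_|_]; last by case: eqP => [_|_]; rewrite cE !ffunE.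
  by rewrite cE !ffunE /= !invMg !mulgA.
- by move=> j1 j2; rewrite !ffunE => /s_inj/swap_inj.
- apply/ffunP => j; rewrite !ffunE /=.
  case: eqP => [_|_]; first by rewrite cE !ffunE.
  case: eqP => [_|_]; last by rewrite cE !ffunE.
  by rewrite cE !ffunE /= !invMg !invgK !mulgA.
- by move=> j1 j2; rewrite !ffunE => /s_inj/swap_inj.
Qed.

Lemma brun_etgt c0 wd st : valid_bword wd ->
  st.1 = etgt c0 st.2 /\ injective st.2.2 ->
  (brun wd st).1 = etgt c0 (brun wd st).2 /\ injective (brun wd st).2.2.
Proof.
elim: wd st => [|p wd IH] st //; rewrite /valid_bword /= => /andP[vp vwd] Pst.
exact/IH/bstep_etgt.
Qed.

Lemma braid_eltP q c : q \in braid_group ->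
  q (c, elt1) = (etgt c (braid_elt q c), braid_elt q c) /\
  injective (braid_elt q c).2.
Proof.
case/braid_wordP=> wd vwd qE; rewrite /braid_elt qE.
have [] := @brun_etgt c wd (c, elt1) vwd.
  by rewrite etgt1; split=> // j1 j2; rewrite !ffunE.
by case: brun => c' a' /= -> ?.
Qed.

(** Permutations compose from left to right, so [r] starts from the grading that [q] has produced; a
    translation brings its run back to [elt1]. *)
Lemma braid_eltM q r c : q \in braid_group -> r \in braid_group ->
  braid_elt (q * r)%g c = elt_mul (braid_elt r (etgt c (braid_elt q c))) (braid_elt q c).
Proof.
move=> qG rG; rewrite {1}/braid_elt permM; have [-> _] := braid_eltP c qG.
set b := braid_elt q c; set c' := etgt c b.
rewrite -{1}(elt_mul1 b) -[(c', _)]/(translate b (c', elt1)).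
by rewrite braid_translate.
Qed.

Lemma belt_word_perm c wd (vwd : valid_bword wd) :
  braid_elt (word_perm vwd) c = belt c wd.
Proof. by rewrite /braid_elt permE. Qed.

Lemma Aset_braid c : Aset c = [set braid_elt q c | q in braid_group].
Proof.
apply/setP=> a; rewrite inE; apply/asboolP/imsetP => [[wd [vwd <-]] | [q qG ->]].
  by exists (word_perm vwd); rewrite ?word_perm_in ?belt_word_perm.
by have [wd vwd qE] := braid_wordP qG; exists wd; rewrite /braid_elt qE.
Qed.

(** Orbit-stabiliser: by [braid_eltP] the element determines the whole image of [(c, elt1)], so the
    fibres of [braid_elt] at [c] are cosets of the stabiliser, all of the same order [m]. *)
Lemma sum_braid_elt (k : fieldType) (f : elt gT n -> k) c :
  exists2 m, #|braid_group| = (m * #|Aset c|)%N &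
    \sum_(q in braid_group) f (braid_elt q c) = m%:R * \sum_(a in Aset c) f a.
Proof.
set m := #|'C_braid_group[(c, elt1) : state | 'P]%g|.
have card_fib a : a \in Aset c ->
  #|[pred q in braid_group | braid_elt q c == a]| = m.
  rewrite Aset_braid => /imsetP[q qG aE].
  rewrite /m -(card_rcoset _ q) -amove_act ?subsetT //.
  apply: eq_card => r; rewrite inE [RHS]inE; apply: andb_id2l => rG.
  rewrite /= /aperm aE; apply/eqP/eqP => [E|]; last by rewrite /braid_elt => ->.
  by have [-> _] := braid_eltP c rG; have [-> _] := braid_eltP c qG; rewrite E.
have sub : {in braid_group, forall q, braid_elt q c \in Aset c}.
  by move=> q qG; rewrite Aset_braid; apply/imsetP; exists q.
exists m.
  rewrite -sum1_card (partition_big _ (mem (Aset c)) sub) /=.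
  rewrite (eq_bigr (fun=> m)) => [|a /card_fib <-]; last by rewrite sum1_card.
  by rewrite sum_nat_const mulnC.
rewrite (partition_big _ (mem (Aset c)) sub) /= mulr_sumr.
apply: eq_bigr => a aA; rewrite -(card_fib a aA).
rewrite (eq_bigr (fun=> f a)) => [|q /andP[_ /eqP-> //]].
by rewrite sumr_const mulr_natl.
Qed.

(** Replaces the sets A_gamma, which vary with the grading, by one group common to all words of
    length [n]. *)
Lemma average_Aset (k : fieldType) (f : elt gT n -> k) c : [pchar k] =i pred0 ->
  #|Aset c|%:R^-1 * \sum_(a in Aset c) f a =
  #|braid_group|%:R^-1 * \sum_(q in braid_group) f (braid_elt q c).
Proof.
move=> char0; have [m cardG ->] := sum_braid_elt f c.
have m_neq0 : m%:R != 0 :> k.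
  rewrite (iffLR (pcharf0P k) char0) -lt0n.
  by have := cardG_gt0 braid_group; rewrite cardG muln_gt0 => /andP[].
by rewrite cardG natrM invfM mulrACA mulVf // mul1r.
Qed.

End BraidGroup.

(** * Braidization as a projection *)

Section BraidRepresentation.
Variables (gT : finGroupType) (k : fieldType) (J : finType).
Variables (deg : J -> gT) (act : gT -> J -> J -> k).
Hypothesis act1 : forall i j, act 1%g i j = (i == j)%:R.
Hypothesis actM : forall g h i j,
  act (g * h)%g i j = \sum_l act g i l * act h l j.
Hypothesis act_deg : forall g i j, act g i j != 0 -> deg i = (g * deg j * g^-1)%g.

Local Notation ecoef := (@ecoef gT k J act _).
Local Notation degt := (@degt gT J deg _).
Local Notation BG n := (braid_group gT n).

Lemma ecoef1 n (u w : n.-tuple J) : ecoef (elt1 gT n) u w = (u == w)%:R.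
Proof.
case: eqVneq => [->|/eqP ne_uw].
  by apply: big1 => j _; rewrite !ffunE act1 eqxx.
apply/eqP; apply: contra_notT ne_uw => /prodf_neq0 nz.
apply: eq_from_tnth => j; have := nz j isT; rewrite !ffunE act1.
by case: (tnth u j =P tnth w j) => //; rewrite eqxx.
Qed.

Lemma ecoef_degt n (a : elt gT n) u w :
  ecoef a u w != 0 -> degt u = etgt (degt w) a.
Proof.
move=> /prodf_neq0 nz; apply/ffunP => j; rewrite !ffunE.
exact/act_deg/nz.
Qed.

Lemma ecoef_mul n (a b : elt gT n) u w : injective a.2 ->
  \sum_v ecoef a u v * ecoef b v w = ecoef (elt_mul a b) u w.
Proof.
move=> a_inj.
rewrite (sum_prod_perm (fun j x => act (a.1 j) (tnth u j) x)
  (fun j x => act (b.1 j) x (tnth w (b.2 j))) a_inj).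
by apply: eq_bigr => j _; rewrite !ffunE actM.
Qed.

(** The matrix of a braid; the element that acts is chosen by the grading of the source word [w]. *)
Definition rho n (q : {perm state gT n}) (u w : n.-tuple J) : k :=
  ecoef (braid_elt q (degt w)) u w.

Lemma rho1 n (u w : n.-tuple J) : rho 1%g u w = (u == w)%:R.
Proof. by rewrite /rho /braid_elt perm1 ecoef1. Qed.

Lemma rhoM n (q r : {perm state gT n}) u w : q \in BG n -> r \in BG n ->
  \sum_v rho r u v * rho q v w = rho (q * r)%g u w.
Proof.
move=> qG rG; rewrite /rho braid_eltM // -ecoef_mul; last first.
  by have [] := braid_eltP (etgt (degt w) (braid_elt q (degt w))) rG.
apply: eq_bigr => v _.
(* Only middle words graded by the target of [q] contribute, and for these [r] acts through the
   element that [braid_eltM] prescribes. *)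
have [->|/ecoef_degt->//] := eqVneq (ecoef (braid_elt q (degt w)) v w) 0.
by rewrite !mulr0.
Qed.

Definition Bker n (u w : n.-tuple J) : k :=
  #|BG n|%:R^-1 * \sum_(q in BG n) rho q u w.

Lemma Bker_rhol n (q : {perm state gT n}) u w : q \in BG n ->
  \sum_v rho q u v * Bker v w = Bker u w.
Proof.
move=> qG; rewrite /Bker.
under eq_bigr do rewrite mulrCA mulr_sumr.
rewrite -mulr_sumr exchange_big /=; congr (_ * _).
(* Multiplication by [q] permutes the group, so the average is unchanged. *)
rewrite [RHS](reindex_inj (mulIg q)) /=; apply: eq_big => r.
  by rewrite groupMr.
by move=> rG; rewrite rhoM.
Qed.

Lemma Bker_rhor n (q : {perm state gT n}) u w : q \in BG n ->
  \sum_v Bker u v * rho q v w = Bker u w.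
Proof.
move=> qG; rewrite /Bker.
under eq_bigr do rewrite -mulrA mulr_suml.
rewrite -mulr_sumr exchange_big /=; congr (_ * _).
rewrite [RHS](reindex_inj (mulgI q)) /=; apply: eq_big => r.
  by rewrite groupMl.
by move=> rG; rewrite rhoM.
Qed.

Lemma isBr_rho x : isBr deg act x <->
  forall n (q : {perm state gT n}) u, q \in BG n ->
    \sum_(w : n.-tuple J) x w * rho q u w = x u.
Proof.
split=> [Br_x n q u qG | fix_x n wd u vwd].
  have [wd vwd qE] := braid_wordP qG; rewrite -[RHS](Br_x n wd u vwd).
  by apply: eq_bigr => w _; rewrite /rho /braid_elt qE.
rewrite -(fix_x n (word_perm gT vwd) u (word_perm_in gT vwd)).
by apply: eq_bigr => w _; rewrite /rho belt_word_perm.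
Qed.

Hypothesis char0 : [pchar k] =i pred0.

Lemma card_braid_neq0 n : #|BG n|%:R != 0 :> k.
Proof. by rewrite (iffLR (pcharf0P k) char0) -lt0n cardG_gt0. Qed.

Lemma braidize_tuple x n (u : n.-tuple J) :
  braidize deg act x u = \sum_(w : n.-tuple J) x w * Bker u w.
Proof.
rewrite /braidize (in_tupleE_dep (fun n u => braidize_n deg act x u)).
apply: eq_bigr => w _; congr (_ * _).
exact: (average_Aset (fun a => ecoef a u w)).
Qed.

Lemma braidize_isBr x : isBr deg act (braidize deg act x).
Proof.
apply/isBr_rho => n q u qG.
under eq_bigr do rewrite braidize_tuple mulr_suml.
rewrite exchange_big braidize_tuple; apply: eq_bigr => w _ /=.
rewrite -(Bker_rhol u w qG) mulr_sumr; apply: eq_bigr => v _.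
by rewrite -mulrA [rho _ _ _ * _]mulrC.
Qed.

Lemma braidize_id x : isBr deg act x -> braidize deg act x = x.
Proof.
move/isBr_rho=> Br_x; apply/funext => u.
rewrite -[u]/(val (in_tuple u)) braidize_tuple.
under eq_bigr do rewrite /Bker mulrCA mulr_sumr.
rewrite -mulr_sumr exchange_big /=.
rewrite (eq_bigr (fun=> x u)) => [|q qG]; last exact: (Br_x _ q (in_tuple u)).
by rewrite sumr_const -(mulr_natl (x u)) mulrA mulVf ?mul1r ?card_braid_neq0.
Qed.

(* The functionals on words that vanish on b v - v for every braid generator b. *)
Definition coinvariant (F : seq J -> k) := forall s1 a b s2,
  F (s1 ++ a :: b :: s2) = \sum_c act (deg a) c b * F (s1 ++ c :: a :: s2).

Lemma valid_bword1 n (p : 'I_n * bool) : valid_gen p -> valid_bword [:: p].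
Proof. by rewrite /valid_bword /= andbT. Qed.

Definition gen_perm n (p : 'I_n * bool) (vp : valid_gen p) : {perm state gT n} :=
  word_perm gT (valid_bword1 vp).

(** A generator sends a basis tensor to a pure tensor. Its factors are listed twice, in [fs] as
    computed by [bstep] and in [fs'] in closed form, and then [tsum] collapses all but one of
    them. *)
Lemma sum_rho_gen n (i : 'I_n) (vi : valid_gen (i, true)) (w : n.-tuple J)
    s1 a b s2 (F : seq J -> k) : w = s1 ++ a :: b :: s2 :> seq J -> size s1 = i ->
  \sum_(v : n.-tuple J) F v * rho (gen_perm vi) v w =
  \sum_c act (deg a) c b * F (s1 ++ c :: a :: s2).
Proof.
move=> wE s1E; set c := degt w; set g := braid_elt (gen_perm vi) c.
pose fs := [tuple (fun z => act (g.1 j) z (tnth w (g.2 j))) | j < n].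
pose fs' := map (@delta k J) s1 ++
  (fun z => act (deg a) z b) :: map (@delta k J) (a :: s2).
have size_s2 : n = (i + (size s2).+2)%N.
  by rewrite -s1E -[RHS](size_cat s1 (a :: b :: s2)) -wE size_tuple.
have nthw j : tnth w j = nth a (s1 ++ a :: b :: s2) j by rewrite (tnth_nth a) wE.
have vi' := val_insubd_succ vi.
(* Three cases: position [i] receives [b] acted on by [deg a], position [i.+1] receives [a], every
   other position keeps its letter. *)
have fsE : fs = fs' :> seq (J -> k).
  apply: (@eq_from_nth _ (@delta k J a)) => [|j].
    by rewrite size_tuple size_cat /= !size_map s1E.
  rewrite size_tuple => lt_jn; rewrite -[j]/(val (Ordinal lt_jn)) -tnth_nth tnth_mktuple.
  apply/funext => z; rewrite /g /braid_elt permE /= !ffunE.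
  rewrite nth_cat size_map s1E.
  set o := Ordinal lt_jn.
  case: (eqVneq o i) => [oi|ne_oi].
    have -> : j = i by rewrite -oi.
    rewrite mulg1 ltnn subnn /= !nthw vi' /= !nth_cat s1E ltnn subnn /=.
    by rewrite ltnNge leqnSn /= subSnn.
  case: (eqVneq o (insubd i i.+1)) => [oi'|ne_oi'].
    have -> : j = i.+1 by rewrite -vi' -oi'.
    by rewrite act1 ltnNge leqnSn /= subSnn /= nthw nth_cat s1E ltnn subnn.
  rewrite act1 nthw /= nth_cat s1E.
  case: ltnP => [lt_ji|le_ij]; first by rewrite (nth_map a) ?s1E.
  have lt_ij : (i.+1 < j)%N.
    rewrite ltn_neqAle (ltn_neqAle i) le_ij andbT.
    by rewrite -vi' (eq_sym (val _)) (eq_sym (val i)); apply/andP.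
  have [m jE] : exists m, j = (i + m.+2)%N.
    by exists (j - i.+2)%N; rewrite !addnS -!addSn subnKC.
  rewrite jE addKn /= (nth_map a) // -2!ltnS -(ltn_add2l i) -jE.
  by move: (lt_jn); rewrite [X in (_ < X)%N]size_s2.
transitivity (tsum fs F).
  rewrite tsumE size_tuple; apply: eq_bigr => v _.
  rewrite mulrC; congr (_ * _); rewrite -pairprod_tuple.
  by apply: eq_bigr => j _; rewrite tnth_mktuple.
rewrite fsE tsum_delta /=; apply: eq_bigr => z _; congr (_ * _).
by rewrite sum_delta -[map _ s2]cats0 tsum_delta /= cats0.
Qed.

(** Coinvariance speaks of positive generators only; inverses and products are reached by absorbing
    into [F] the braid that acts last. *)
Lemma coinvariant_rho F n (q : {perm state gT n}) (w : n.-tuple J) :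
  coinvariant F -> q \in BG n -> \sum_(v : n.-tuple J) F v * rho q v w = F w.
Proof.
move=> coF qG; have [wd vwd qE] := braid_wordP qG.
have {qE qG} -> : q = word_perm gT vwd by apply/permP => st; rewrite permE qE.
pose fixed (r : {perm state gT n}) := forall w : n.-tuple J,
  \sum_(v : n.-tuple J) F v * rho r v w = F w.
have fixed1 : fixed 1%g.
  move=> w'; rewrite (bigD1 w') //= rho1 eqxx mulr1 big1 ?addr0 // => v /negPf ne.
  by rewrite rho1 ne mulr0.
have fixed_mul q1 q2 w' : q1 \in BG n -> q2 \in BG n -> fixed q2 ->
    \sum_(v : n.-tuple J) F v * rho (q1 * q2)%g v w' =
    \sum_(v : n.-tuple J) F v * rho q1 v w'.
  move=> q1G q2G fix2.
  under eq_bigr do rewrite -rhoM // mulr_sumr.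
  rewrite exchange_big; apply: eq_bigr => t _ /=.
  by rewrite -[F t]fix2 mulr_suml; apply: eq_bigr => v _; rewrite mulrA.
have fixed_pos (i : 'I_n) (vi : valid_gen (i, true)) : fixed (gen_perm vi).
  move=> w'; have [s1 [a [b [s2 [wE s1E]]]]] : exists s1 a b s2,
      w' = s1 ++ a :: b :: s2 :> seq J /\ size s1 = i.
    exists (take i w'), (tnth w' i), (tnth w' (insubd i i.+1)), (drop i.+2 w').
    rewrite size_take size_tuple ltn_ord; split=> //.
    (* [a0] serves only as the default letter of [nth]. *)
    have a0 := tnth w' i; rewrite !(tnth_nth a0) val_insubd_succ //.
    rewrite -!drop_nth ?cat_take_drop // size_tuple //.
  by rewrite (sum_rho_gen vi F wE s1E) -coF wE.
have fixed_gen p (vp : valid_gen p) : fixed (gen_perm vp).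
  case: p vp => i [] vp; first exact: fixed_pos.
  have vi : valid_gen (i, true) := vp.
  (* A negative generator followed by its positive partner is trivial, and the positive one is
     absorbed by [F]. *)
  have qK : (gen_perm vp * gen_perm vi = 1)%g.
    by apply/permP => st; rewrite permM !permE /= (bstepK st vp).
  move=> w'; rewrite -(fixed_mul (gen_perm vp) (gen_perm vi)) ?word_perm_in //.
  by rewrite qK fixed1.
suff: fixed (word_perm gT vwd) by apply.
elim: wd vwd => [|p wd IH] vwd.
  by have -> : word_perm gT vwd = 1%g by apply/permP => st; rewrite permE perm1.
have /andP[vp vwd'] : valid_gen p && valid_bword wd := vwd.
have -> : word_perm gT vwd = (gen_perm vp * word_perm gT vwd')%g.
  by apply/permP => st; rewrite permM !permE.
by move=> w'; rewrite fixed_mul ?word_perm_in // fixed_gen.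
Qed.

Lemma coinvariant_Bker F n (w : n.-tuple J) : coinvariant F ->
  \sum_(v : n.-tuple J) F v * Bker v w = F w.
Proof.
move=> coF; under eq_bigr do rewrite /Bker mulrCA mulr_sumr.
rewrite -mulr_sumr exchange_big /=.
rewrite (eq_bigr (fun=> F w)) => [|q qG]; last exact: coinvariant_rho.
by rewrite sumr_const -(mulr_natl (F w)) mulrA mulVf ?mul1r ?card_braid_neq0.
Qed.

(* The coefficient of e_u in B(e_w), as a functional of the word w; it is 0 when
   the lengths of u and w differ. *)
Definition Brow (u w : seq J) : k :=
  if insub w is Some t then Bker (in_tuple u) t else 0.

Lemma Brow_tuple u (w : (size u).-tuple J) : Brow u w = Bker (in_tuple u) w.
Proof. by rewrite /Brow valK. Qed.

(** This is [Bker_rhor] for a single generator, read on words through [sum_rho_gen]; when the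
    lengths differ both sides vanish. *)
Lemma Brow_coinvariant u : coinvariant (Brow u).
Proof.
move=> s1 a b s2.
have [eq_sz|ne_sz] := eqVneq (size (s1 ++ a :: b :: s2)) (size u); last first.
  rewrite /Brow insubF ?(negPf ne_sz) // big1 // => c _.
  by rewrite insubF ?mulr0 // -(negPf ne_sz) !size_cat.
have w_u : size (s1 ++ a :: b :: s2) == size u by apply/eqP.
pose w := Tuple w_u; have vi' : ((size s1).+1 < size u)%N.
  by rewrite -eq_sz size_cat /= !addnS !ltnS leq_addr.
pose i : 'I_(size u) := Ordinal (ltnW vi').
have vi : valid_gen (i, true) by [].
have wE : w = s1 ++ a :: b :: s2 :> seq J by [].
rewrite -(sum_rho_gen vi (Brow u) wE (erefl _)) -[LHS]/(Brow u w) Brow_tuple.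
rewrite -(Bker_rhor _ _ (word_perm_in gT (valid_bword1 vi))).
by apply: eq_bigr => v _; rewrite Brow_tuple.
Qed.

(** A generator acting inside a factor is also a generator for the whole word. *)
Lemma coinvariant_cat F s t : coinvariant F -> coinvariant (fun v => F (s ++ v ++ t)).
Proof.
move=> coF s1 a b s2; rewrite -!catA catA /= coF.
by apply: eq_bigr => c _; rewrite -!catA.
Qed.

(** The averaging moves from [x] to [F], which absorbs it. *)
Lemma coinvariant_braidize F n x : coinvariant F ->
  sumw n (fun v => braidize deg act x v * F v) = sumw n (fun v => x v * F v).
Proof.
move=> coF; rewrite /sumw; under eq_bigr do rewrite braidize_tuple mulr_suml.
rewrite exchange_big; apply: eq_bigr => w _ /=.
rewrite -(coinvariant_Bker w coF) mulr_sumr; apply: eq_bigr => v _.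
by rewrite -mulrA [Bker _ _ * _]mulrC.
Qed.

(** * The multiplication *)

Lemma circE x y u : circ deg act x y u =
  sumw (size u) (fun w => juxt x y w * Brow u w).
Proof.
rewrite /circ -[u in LHS]/(val (in_tuple u)) braidize_tuple.
by apply: eq_bigr => w _; rewrite Brow_tuple.
Qed.

Lemma coinvariant_juxtl F n x y : coinvariant F ->
  sumw n (fun w => juxt (braidize deg act x) y w * F w) =
  sumw n (fun w => juxt x y w * F w).
Proof.
move=> coF; rewrite !sum_juxt; apply: eq_bigr => p _.
(* The right factor [w] is fixed first, so that the inner sum pairs the left factor with the
   coinvariant functional [fun v => F (v ++ w)]. *)
rewrite /sumw exchange_big [RHS]exchange_big; apply: eq_bigr => w _ /=.
transitivity (y w * sumw p (fun v => braidize deg act x v * F (v ++ w))).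
  by rewrite mulr_sumw; apply: eq_bigr => v _; rewrite mulrA [y w * _]mulrC.
rewrite (@coinvariant_braidize (fun v => F (v ++ w))); last exact: (@coinvariant_cat F [::]).
by rewrite mulr_sumw; apply: eq_bigr => v _; rewrite mulrA [y w * _]mulrC.
Qed.

Lemma coinvariant_juxtr F n x y : coinvariant F ->
  sumw n (fun w => juxt x (braidize deg act y) w * F w) =
  sumw n (fun w => juxt x y w * F w).
Proof.
move=> coF; rewrite !sum_juxt; apply: eq_bigr => p _.
apply: eq_sumw => v _.
transitivity (x v * sumw (n - p) (fun w => braidize deg act y w * F (v ++ w))).
  by rewrite mulr_sumw; apply: eq_sumw => w _; rewrite mulrA.
rewrite (@coinvariant_braidize (fun w => F (v ++ w))); last first.
  have := @coinvariant_cat F v [::] coF.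
  by congr coinvariant; apply/funext => w; rewrite cats0.
by rewrite mulr_sumw; apply: eq_sumw => w _; rewrite mulrA.
Qed.

Lemma circA x y z :
  circ deg act (circ deg act x y) z = circ deg act x (circ deg act y z).
Proof.
apply/funext => u; rewrite !circE.
rewrite coinvariant_juxtl ?coinvariant_juxtr; try exact: Brow_coinvariant.
by rewrite juxtA.
Qed.

(** * Moving one word across another *)

Lemma pairprod1 (v w : seq J) : size v = size w ->
  pairprod (act 1%g) v w = (v == w)%:R.
Proof.
elim: v w => [|a v IH] [|b w] //= [/IH->]; rewrite act1 eqseq_cons.
by rewrite -natrM mulnb.
Qed.

Lemma pairprod_act_mul g h n (u w : seq J) : size u = n -> size w = n ->
  sumw n (fun v => pairprod (act g) u v * pairprod (act h) v w) =
  pairprod (act (g * h)%g) u w.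
Proof.
elim: n u w => [|n IH] [|a u] [|b w] //= => [_ _|[szu] [szw]].
  by rewrite sumw0 mulr1.
rewrite sumwS actM mulr_suml; apply: eq_bigr => c _ /=.
rewrite -(IH u w szu szw) mulr_sumw; apply: eq_sumw => v _.
by rewrite mulrACA.
Qed.

(** The letter [a] passes the letters of [w] one by one, acting on each; a letter already passed
    joins the prefix, whence the general [s]. *)
Lemma coinvariant_cross1 F s a w t : coinvariant F ->
  F (s ++ a :: w ++ t) =
  sumw (size w) (fun v => pairprod (act (deg a)) v w * F (s ++ v ++ a :: t)).
Proof.
move=> coF; elim: w s => [|b w IH] s /=; first by rewrite sumw0 mul1r.
rewrite sumwS coF; apply: eq_bigr => c _ /=.
rewrite -cat_rcons IH mulr_sumw; apply: eq_sumw => v _.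
by rewrite mulrA cat_rcons.
Qed.

Lemma coinvariant_cross F v w t : coinvariant F ->
  F (v ++ w ++ t) =
  sumw (size w)
    (fun w' => pairprod (act (\prod_(j <- v) deg j)%g) w' w * F (w' ++ v ++ t)).
Proof.
elim: v F => [|a v IH] F coF /=.
  rewrite /sumw (bigD1 (in_tuple w)) //= big_nil pairprod1 // eqxx mul1r big1 ?addr0 //.
  move=> w' ne_w'; rewrite pairprod1 ?size_tuple //.
  by rewrite -[w]/(val (in_tuple w)) val_eqE (negPf ne_w') mul0r.
(* The tail of [v] crosses first, behind the fixed letter [a]; then [a] crosses the result, and the
   two actions compose by [pairprod_act_mul]. *)
have coFa : coinvariant (fun v => F (a :: v)).
  by move=> s1 b c s2; rewrite -cat_cons coF.
rewrite (IH _ coFa).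
under eq_sumw => w' sz_w' do
  rewrite (@coinvariant_cross1 F [::] a w' (v ++ t)) // sz_w' /= mulr_sumw.
rewrite /sumw exchange_big; apply: eq_bigr => u _ /=.
rewrite big_cons -(@pairprod_act_mul _ _ (size w)) ?size_tuple //.
rewrite mulr_suml; apply: eq_bigr => w' _.
by rewrite mulrA [pairprod _ w' w * _]mulrC.
Qed.

Lemma tgact_sumw g y u :
  tgact act g y u = sumw (size u) (fun w => y w * pairprod (act g) u w).
Proof. by apply: eq_bigr => w _; rewrite pairprod_tuple. Qed.

(** Every word in the support of [x] has total degree [g], so it acts by [g] on whatever it crosses,
    which produces [tgact act g y]. *)
Lemma circ_comm g x y : homog deg g x ->
  circ deg act x y = circ deg act (tgact act g y) x.
Proof.
move=> xg; apply/funext => u; rewrite !circE !sum_juxt.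
have coF := Brow_coinvariant u; move: (Brow u) coF (size u) => F coF n.
(* The factors change places, so a cut at [p] corresponds to a cut at [n - p]. *)
rewrite [RHS](reindex_inj rev_ord_inj) /=; apply: eq_bigr => p _.
have le_pn : (p <= n)%N by rewrite -ltnS.
rewrite subSS subKn //.
transitivity (sumw p (fun v => sumw (n - p) (fun w' =>
    x v * tgact act g y w' * F (w' ++ v)))); last first.
  rewrite {1}/sumw exchange_big; apply: eq_bigr => w' _; apply: eq_bigr => v _.
  by rewrite [x v * _]mulrC.
apply: eq_sumw => v _; have [->|/xg vg] := eqVneq (x v) 0.
  by rewrite /sumw !big1 // => w _; rewrite !mul0r.
transitivity (sumw (n - p) (fun w => sumw (n - p) (fun w' =>
    x v * y w * pairprod (act g) w' w * F (w' ++ v)))).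
  apply: eq_sumw => w sz_w; rewrite -[v ++ w](cats0 (v ++ w)) -catA.
  rewrite (coinvariant_cross _ _ _ coF) sz_w vg mulr_sumw.
  by apply: eq_sumw => w' _; rewrite cats0 mulrA.
rewrite {1}/sumw exchange_big; apply: eq_bigr => w' _.
rewrite tgact_sumw size_tuple mulr_sumr mulr_suml; apply: eq_bigr => w _ /=.
by rewrite mulrA.
Qed.

Lemma tone_isBr : isBr deg act (@tone k J).
Proof.
move=> [|n] wd u vwd; rewrite /bact.
  rewrite (bigD1 [tuple]) //= big1 => [|w]; last by rewrite tuple0 => /eqP.
  by rewrite /ecoef big_ord0 mulr1 addr0 tuple0.
by case/tupleP: u => a u; rewrite big1 // => w _; case/tupleP: w => b w; rewrite mul0r.
Qed.

Lemma circ_linearl a x y z : circ deg act (fun u => a * x u + y u) z =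
  (fun u => a * circ deg act x z u + circ deg act y z u).
Proof.
apply/funext => u; rewrite !circE mulr_sumw -sumwD; apply: eq_sumw => w _.
by rewrite juxt_linearl mulrDl mulrA.
Qed.

Lemma circ_linearr a x y z : circ deg act z (fun u => a * x u + y u) =
  (fun u => a * circ deg act z x u + circ deg act z y u).
Proof.
apply/funext => u; rewrite !circE mulr_sumw -sumwD; apply: eq_sumw => w _.
by rewrite juxt_linearr mulrDl mulrA.
Qed.

Lemma circ_braided_comm_unital : braided_comm_unital_algebra deg act.
Proof.
split; first by move=> x y _ _; apply: braidize_isBr.
split; first exact: tone_isBr.
split; first by move=> x y z _ _ _; apply: circA.
split; first by move=> x Br_x; rewrite /circ juxt1l juxt1r braidize_id.
split; first by move=> a x y z _ _ _; rewrite circ_linearl circ_linearr.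
by move=> g x y _ _; apply: circ_comm.
Qed.

End BraidRepresentation.

(** * Functoriality *)

Section Pullback.
Variables (gT : finGroupType) (k : fieldType) (H K : gmod gT k).
Variable phi : gidx K -> gidx H -> k.

Local Notation degH := (@dual_deg gT k H).
Local Notation actH := (@dual_act gT k H).
Local Notation degK := (@dual_deg gT k K).
Local Notation actK := (@dual_act gT k K).

Lemma pullback_sumw y w :
  pullback phi y w = sumw (size w) (fun u => y u * pairprod phi u w).
Proof.
apply: eq_bigr => u _.
by rewrite (pairprod_tuple phi u (in_tuple w)).
Qed.

Lemma pullback_tone : pullback phi (@tone k (gidx K)) = @tone k (gidx H).
Proof.
apply/funext => -[|a w]; rewrite pullback_sumw /=; first by rewrite sumw0 mulr1.
by rewrite sumwS big1 // => j _; rewrite /sumw big1 // => u _; rewrite mul0r.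
Qed.

Lemma pullback_juxt y z :
  pullback phi (juxt y z) = juxt (pullback phi y) (pullback phi z).
Proof.
apply/funext => w; rewrite pullback_sumw sum_juxt; apply: eq_bigr => p _.
have le_pw : (p <= size w)%N by rewrite -ltnS.
rewrite !pullback_sumw size_drop size_takel //.
rewrite /sumw mulr_suml; apply: eq_bigr => v _.
rewrite mulr_sumr; apply: eq_bigr => u _.
rewrite -[X in pairprod _ (_ ++ _) X](cat_take_drop p w) pairprod_cat ?size_takel ?size_tuple //.
by rewrite mulrACA.
Qed.

Hypothesis phi_mor : gmod_mor phi.

Lemma phi_degt n (u : n.-tuple (gidx K)) (w : n.-tuple (gidx H)) :
  pairprod phi u w != 0 -> degt degK u = degt degH w.
Proof.
rewrite -pairprod_tuple => /prodf_neq0 nz; apply/ffunP => j; rewrite !ffunE.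
by rewrite /dual_deg (phi_mor.1 _ _ (nz j isT)).
Qed.

(** As [phi] preserves degrees, both sides use the same element of G^n x| S_n; equivariance of [phi]
    then applies at each position. *)
Lemma rho_pullback n (q : {perm state gT n}) (w : n.-tuple (gidx K))
    (v : n.-tuple (gidx H)) : q \in braid_group gT n ->
  \sum_(u : n.-tuple (gidx K)) rho degK actK q u w * pairprod phi u v =
  \sum_(u : n.-tuple (gidx H)) rho degH actH q v u * pairprod phi w u.
Proof.
move=> qG; rewrite /rho.
transitivity (\sum_(u : n.-tuple (gidx H))
    ecoef actH (braid_elt q (degt degK w)) v u * pairprod phi w u); last first.
  apply: eq_bigr => u _; have [->|/phi_degt->//] := eqVneq (pairprod phi w u) 0.
  by rewrite !mulr0.
set a := braid_elt _ _; have [_ a_inj] := braid_eltP (degt degK w) qG.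
under eq_bigr do rewrite -pairprod_tuple.
under [RHS]eq_bigr do rewrite -pairprod_tuple.
rewrite (sum_prod_perm (fun j x => actK (a.1 j) x (tnth w (a.2 j)))
  (fun j x => phi x (tnth v j)) (s := id)) //.
rewrite (sum_prod_perm (fun j x => actH (a.1 j) (tnth v j) x)
  (fun j x => phi (tnth w j) x) a_inj).
(* With the dual action unfolded, this is the equivariance of [phi] at the inverse of [a.1 j]. *)
apply: eq_bigr => j _; rewrite /dual_act /=.
rewrite (phi_mor.2 _ _ _); apply: eq_bigr => i _.
by rewrite mulrC.
Qed.

Hypothesis char0 : [pchar k] =i pred0.

(** The averaging group depends on [gT] and the length only, hence is the same for both modules, and
    [rho_pullback] applies term by term. *)
Lemma pullback_braidize y :
  pullback phi (braidize degK actK y) = braidize degH actH (pullback phi y).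
Proof.
apply/funext => v; rewrite -[v in RHS]/(val (in_tuple v)) braidize_tuple //.
rewrite pullback_sumw /sumw.
under eq_bigr do rewrite braidize_tuple // mulr_suml.
under [RHS]eq_bigr do rewrite pullback_sumw size_tuple mulr_suml.
rewrite exchange_big [RHS]exchange_big; apply: eq_bigr => w _ /=.
under eq_bigr do rewrite -mulrA.
under [RHS]eq_bigr do rewrite -mulrA.
rewrite -!mulr_sumr; congr (_ * _).
rewrite /Bker; under eq_bigr do rewrite -mulrA mulr_suml.
under [RHS]eq_bigr do rewrite mulrCA mulr_sumr.
rewrite -!mulr_sumr; congr (_ * _).
rewrite exchange_big [RHS]exchange_big; apply: eq_bigr => q qG /=.
rewrite (rho_pullback w (in_tuple v) qG).
by apply: eq_bigr => u _; rewrite mulrC.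
Qed.

End Pullback.

(** * The dual as a graded module *)

Section Dual.
Variables (gT : finGroupType) (k : fieldType) (H : gmod gT k).
Local Notation act := (@dual_act gT k H).
Local Notation deg := (@dual_deg gT k H).

Lemma dual_act1 i j : act 1%g i j = (i == j)%:R.
Proof. by rewrite /dual_act invg1 Defs.gact1 eq_sym. Qed.

Lemma dual_actM g h i j :
  act (g * h)%g i j = \sum_l act g i l * act h l j.
Proof.
by rewrite /dual_act invMg Defs.gactM; apply: eq_bigr => l _; rewrite mulrC.
Qed.

Lemma dual_act_deg g i j : act g i j != 0 ->
  deg i = (g * deg j * g^-1)%g.
Proof.
move=> /gact_grade; rewrite /dual_deg invgK => ->.
by rewrite !invMg invgK !mulgA mulgV mul1g mulgK.
Qed.

End Dual.

Theorem theorem2p34 (gT : finGroupType) (k : fieldType)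
    (char0 : [pchar k] =i pred0) (H K : gmod gT k)
    (phi : gidx K -> gidx H -> k) (phi_mor : gmod_mor phi) :
  braided_comm_unital_algebra (@dual_deg gT k H) (@dual_act gT k H) /\
  (forall y, BrH y -> BrH (pullback phi y)) /\
  pullback phi (@tone k (gidx K)) = @tone k (gidx H) /\
  (forall y z, BrH y -> BrH z ->
     pullback phi (circH y z) = circH (pullback phi y) (pullback phi z)).
Proof.
split.
  exact: (circ_braided_comm_unital (@dual_act1 _ _ H) (@dual_actM _ _ H)
            (@dual_act_deg _ _ H) char0).
split=> [y Br_y|].
  (* An invariant series is its own braidization, so its pullback is a braidization too and
     therefore invariant. *)
  rewrite -(braidize_id char0 Br_y) pullback_braidize //.
  exact: (braidize_isBr (@dual_actM _ _ H) (@dual_act_deg _ _ H) char0).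
split; first exact: pullback_tone.
by move=> y z _ _; rewrite /circH /circ pullback_braidize // pullback_juxt.
Qed.
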